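(* Let $\delta>0$, put $C_1=(L_1+L_2)^2/\mu$ and $C_2=1/(8C_1)$, and for $k\ge 0$ let $$\lambda_k=(k+1)^{-1/4},\quad \eta_k=C_1(k+1)^{1/4},\quad \theta_k=C_2(k+1)^{-1/4},\quad N_k=\lceil (k+1)^{1+\delta}\rceil .$$ Let $\{x_k\}_{k\ge 0}$ be the sequence generated by the RVC-IPG iteration (defined in the context) with these parameters, and suppose that the problem assumptions and the stochastic error assumption stated in the context hold. Then for any fixed $\bar\eta\in(0,C_1]$, $$\min_{0\le k\le T-1}\mathbb{E}\big[\|H(x_k,\bar\eta)\|^2\big]=\mathcal{O}\big(1/\sqrt T\big),$$ that is, there is a constant $K>0$ independent of $T$ such that the left-hand side is at most $K/\sqrt T$ for every integer $T\ge1$.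
   Context: Setting. $X\subseteq\mathbb{R}^n$ is a nonempty closed convex set, $\|\cdot\|$ is the Euclidean norm, and $\mathbf{P}_X$ is the Euclidean projection onto $X$. $\xi:\Omega\to\mathbb{R}^d$ is a random vector on a probability space $(\Omega,\mathcal{F},\mathbb{P})$, $G:\mathbb{R}^n\times\mathbb{R}^d\to\mathbb{R}^n$ is measurable, and $F(x)=\mathbb{E}[G(x,\xi)]$ is well defined for every $x\in\mathbb{R}^n$. The stochastic inverse variational inequality (SIVI) is to find $x$ with $F(x)\in X$ and $\langle y-F(x),x\rangle\ge 0$ for all $y\in X$; its solution set is $$S=\{x\in\mathbb{R}^n:\ F(x)\in X,\ \langle y-F(x),x\rangle\ge 0\ \ \forall y\in X\}.$$ Problem assumptions. (i) $F:\mathbb{R}^n\to\mathbb{R}^n$ is monotone ($\langle F(x)-F(y),x-y\rangle\ge0$ for all $x,y$) and $L_1$-Lipschitz continuous; (ii) $\Phi:\mathbb{R}^n\to\mathbb{R}^n$ is $\mu$-strongly monotone ($\langle \Phi(x)-\Phi(y),x-y\rangle\ge\mu\|x-y\|^2$ for all $x,y$, with $\mu>0$) and $L_2$-Lipschitz continuous; (iii) $S\neq\emptyset$. Residual map. For $\eta>0$, $H(x,\eta)=F(x)-\mathbf{P}_X(F(x)-\eta x)$. RVC-IPG iteration. Given $x_0\in\mathbb{R}^n$, positive parameters $\eta_k,\theta_k,\lambda_k$, positive integers $N_k$, and random samples $\xi_{j,k}$ of $\xi$ ($1\le j\le N_k$, $k\ge0$), set $\hat F_k=\frac1{N_k}\sum_{j=1}^{N_k}G(x_k,\xi_{j,k})+\lambda_k\Phi(x_k)$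 and $$z_k=\mathbf{P}_X[\hat F_k-\eta_kx_k],\qquad x_{k+1}=x_k-\theta_k(\hat F_k-z_k),\qquad k\ge 0.$$ Stochastic error assumption. Let $\mathcal{F}_k=\sigma\{x_0,\xi_{j,s}:0\le s\le k-1,\ 1\le j\le N_s\}$ and $\bar w_{k,N_k}=\frac1{N_k}\sum_{j=1}^{N_k}(G(x_k,\xi_{j,k})-F(x_k))$. There exists $\nu>0$ such that for all $k$, almost surely, $\mathbb{E}[\bar w_{k,N_k}\mid\mathcal{F}_k]=0$ and $\mathbb{E}[\|\bar w_{k,N_k}\|^2\mid\mathcal{F}_k]\le \nu^2/N_k$. *)

(* Defs.v *)
From HB Require Import structures.
From mathcomp Require Import all_boot all_order all_algebra.
From mathcomp Require Import all_classical all_reals all_analysis.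

Set Implicit Arguments.
Unset Strict Implicit.
Unset Printing Implicit Defensive.

Import Order.TTheory GRing.Theory Num.Theory.
Import numFieldNormedType.Exports.

Local Open Scope classical_set_scope.
Local Open Scope ring_scope.

(* R^n is 'rV[R]_n.  Its library norm is the sup norm, hence the Euclidean
   norm below; its library topology is the product topology, i.e. the
   Euclidean one. *)
Section Euclidean.
Context {R : realType} {n : nat}.
Implicit Types (u v x y : 'rV[R]_n) (X : set 'rV[R]_n).
Implicit Types (F : 'rV[R]_n -> 'rV[R]_n).

Definition dotp u v : R := \sum_(i < n) u 0 i * v 0 i.

Definition enorm u : R := Num.sqrt (dotp u u).

(* The default value 0 is irrelevant when X is nonempty, closed and convex,
   since the nearest point then exists and is unique. *)
Definition proj X y : 'rV[R]_n :=
  xget 0 [set p | X p /\ forall q, X q -> enorm (y - p) <= enorm (y - q)].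

Definition monotone_map F : Prop :=
  forall x y, 0 <= dotp (F x - F y) (x - y).

Definition strongly_monotone_map (mu : R) F : Prop :=
  forall x y, mu * enorm (x - y) ^+ 2 <= dotp (F x - F y) (x - y).

Definition lipschitz_map (L : R) F : Prop :=
  forall x y, enorm (F x - F y) <= L * enorm (x - y).

Definition sivi_sol X F : set 'rV[R]_n :=
  [set x | X (F x) /\ forall y, X y -> 0 <= dotp (y - F x) x].

Definition residual X F x (eta : R) : 'rV[R]_n :=
  F x - proj X (F x - eta *: x).

End Euclidean.

Notation borel R n := (g_sigma_algebraType (@open 'rV[R]_n)).

Section Probability.
Context {R : realType} {d0 : measure_display} {Omega : measurableType d0}.
Variable P : probability Omega R.

(* Y is a version of the conditional expectation of the integrable real
   random variable Z given the sub-sigma-algebra A. *)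
Definition is_cond_exp (A : set (set Omega)) (Z Y : Omega -> R) : Prop :=
  [/\ P.-integrable setT (EFin \o Z),
      P.-integrable setT (EFin \o Y),
      g_sigma_algebra_preimage Y `<=` A &
      forall B, A B ->
        (\int[P]_(w in B) (Z w)%:E = \int[P]_(w in B) (Y w)%:E)%E].

Definition same_distribution d (T : measurableType d) (X Y : Omega -> T) :
    Prop :=
  forall B, measurable B -> P (X @^-1` B) = P (Y @^-1` B).

Definition mean_map n d (G : 'rV[R]_n -> 'rV[R]_d -> 'rV[R]_n)
    (xi : Omega -> 'rV[R]_d) (x : 'rV[R]_n) : 'rV[R]_n :=
  \row_(i < n) fine 'E_P[fun w => G x (xi w) 0 i].

End Probability.

(* Samples are indexed as xis k j, with iteration k and 0 <= j < N k. *)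
Section Algorithm.
Context {R : realType} {n d : nat}.
Context {d0 : measure_display} {Omega : measurableType d0}.
Implicit Types (X : set 'rV[R]_n) (G : 'rV[R]_n -> 'rV[R]_d -> 'rV[R]_n).
Implicit Types F Phi : 'rV[R]_n -> 'rV[R]_n.
Implicit Types (eta theta lambda : nat -> R) (N : nat -> nat).
Implicit Types (xis : nat -> nat -> Omega -> borel R d).
Implicit Types (x : nat -> Omega -> 'rV[R]_n).

Definition hatF G Phi lambda N xis x (k : nat) (w : Omega) : 'rV[R]_n :=
  (N k)%:R^-1 *: (\sum_(j < N k) G (x k w) (xis k j w))
  + lambda k *: Phi (x k w).

Definition rvc_ipg X G Phi (x0 : 'rV[R]_n) eta theta lambda N xis x : Prop :=
  (forall w, x 0%N w = x0) /\
  (forall k w,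
     let Fk := hatF G Phi lambda N xis x k w in
     let zk := proj X (Fk - eta k *: x k w) in
     x k.+1 w = x k w - theta k *: (Fk - zk)).

Definition history (x0 : 'rV[R]_n) N xis (k : nat) : set (set Omega) :=
  <<s g_sigma_algebra_preimage (cst x0 : Omega -> borel R n)
      `|` \bigcup_(s < k) \bigcup_(j < N s)
            g_sigma_algebra_preimage (xis s j) >>.

Definition avg_error F G N xis x (k : nat) (w : Omega) : 'rV[R]_n :=
  (N k)%:R^-1 *: \sum_(j < N k) (G (x k w) (xis k j w) - F (x k w)).

Definition stochastic_error_assumption (P : probability Omega R)
    F G (x0 : 'rV[R]_n) N xis x : Prop :=
  exists2 nu : R, 0 < nu & forall k,
    (forall i : 'I_n, exists2 Y : Omega -> R,
       is_cond_exp P (history x0 N xis k)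
         (fun w => avg_error F G N xis x k w 0 i) Y &
       {ae P, forall w, Y w = 0}) /\
    (exists2 Y : Omega -> R,
       is_cond_exp P (history x0 N xis k)
         (fun w => enorm (avg_error F G N xis x k w) ^+ 2) Y &
       {ae P, forall w, Y w <= nu ^+ 2 / (N k)%:R}).

End Algorithm.

(* Main.v *)
Require Import Defs.
From HB Require Import structures.
From mathcomp Require Import all_boot all_order all_algebra.
From mathcomp Require Import all_classical all_reals all_analysis.
From mathcomp Require Import measurable_realfun ring lra.

Set Implicit Arguments.
Unset Strict Implicit.
Unset Printing Implicit Defensive.

Import Order.TTheory GRing.Theory Num.Theory.
Import numFieldNormedType.Exports.

Local Open Scope classical_set_scope.
Local Open Scope ring_scope.

(** Why the rate holds.  Write r_k for the residual of the regularised operator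
    F + lambda_k Phi at (x_k, eta_k), w_k for the sampling error and y_k for the
    solution of the inverse variational inequality of F + lambda_k Phi.  The
    proof follows the squared distance of x_k to the moving target y_k, and it
    does so path by path.

    The parameters satisfy eta_k lambda_k mu = (L1 + L2)^2 and
    theta_k eta_k = 1/8.  Since the projection is firmly nonexpansive, this
    balance makes the step x - theta_k r_k a contraction with factor
    1 - theta_k lambda_k mu whose gain also contains a multiple of
    (theta_k / eta_k) |r_k|^2 ([residual_contraction]).  Contractivity gives the
    existence of y_k ([regularized_solution]).  Comparing variational
    inequalities bounds y_k uniformly and gives |y_k - y_{k+1}| = O(1/k)
    ([regularized_solution_drift]).  The projected step changes by at most |w_k|
    under the noise, and Young's inequality absorbs both noise and drift in the
    contraction factor ([noisy_step]):
      |x_{k+1} - y_{k+1}|^2 <= |x_k - y_k|^2 - c_1 k^(-1/2) |r_k|^2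
                                + c_2 |w_k|^2 + c_3 k^(-3/2).
    Telescoping bounds the sum of k^(-1/2) |r_k|^2 and every |x_k - y_k|^2 by a
    constant plus c_2 times the sum of |w_k|^2.

    The residual is nondecreasing in its parameter, so the one at etabar is
    dominated by the one at eta_k, and dropping the regularisation costs
    lambda_k |Phi(x_k)|, whose square is O(k^(-1/2)) times a bounded quantity
    along the path.  Summing, the first T squared residuals of F add up to at
    most sqrt T (A sum |w_k|^2 + B) ([residual_path_sum]).

    The sample sizes make sum 1 / N_k finite, hence the expectation of the bound
    is O(sqrt T); T times the minimum of the expected residuals is below it.
    This last step uses integrals of nonnegative functions only through their
    definition as suprema over simple functions, which are monotone and
    superadditive for all functions, measurable or not
    ([mine_integral_le_avg]). *)

(** * Euclidean geometry and compactness *)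

Section EuclideanSpace.
Context {R : realType} {n : nat}.
Implicit Types (u v w x y : 'rV[R]_n).

Lemma dotpC u v : dotp u v = dotp v u.
Proof. by apply: eq_bigr => i _; rewrite mulrC. Qed.

Lemma dotpDl u v w : dotp (u + v) w = dotp u w + dotp v w.
Proof. by rewrite -big_split; apply: eq_bigr => i _; rewrite mxE mulrDl. Qed.

Lemma dotpZl (a : R) u v : dotp (a *: u) v = a * dotp u v.
Proof. by rewrite mulr_sumr; apply: eq_bigr => i _; rewrite mxE mulrA. Qed.

Lemma dotpNl u v : dotp (- u) v = - dotp u v.
Proof. by rewrite -scaleN1r dotpZl mulN1r. Qed.

Lemma dotpDr u v w : dotp w (u + v) = dotp w u + dotp w v.
Proof. by rewrite dotpC dotpDl !(dotpC w). Qed.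

Lemma dotpZr (a : R) u v : dotp u (a *: v) = a * dotp u v.
Proof. by rewrite dotpC dotpZl dotpC. Qed.

Lemma dotpNr u v : dotp u (- v) = - dotp u v.
Proof. by rewrite dotpC dotpNl dotpC. Qed.

Definition dotpE := (dotpDl, dotpDr, dotpNl, dotpNr, dotpZl, dotpZr).

Lemma dotp_ge0 u : 0 <= dotp u u.
Proof. by apply: sumr_ge0 => i _; rewrite -expr2 sqr_ge0. Qed.

Lemma dotp_eq0 u : dotp u u = 0 -> u = 0.
Proof.
move=> /eqP; rewrite psumr_eq0; last by move=> i _; rewrite -expr2 sqr_ge0.
move=> /allP u0; apply/rowP => i; rewrite mxE; apply/eqP.
by have := u0 i (mem_index_enum i); rewrite mulf_eq0 orbb.
Qed.

Lemma dotp0l u : dotp 0 u = 0.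
Proof. by rewrite -(scale0r (0 : 'rV[R]_n)) dotpZl mul0r. Qed.

Lemma enorm_sqr u : enorm u ^+ 2 = dotp u u.
Proof. by rewrite sqr_sqrtr ?dotp_ge0. Qed.

Lemma enorm_ge0 u : 0 <= enorm u.
Proof. exact: sqrtr_ge0. Qed.

Lemma enorm0 : enorm (0 : 'rV[R]_n) = 0.
Proof. by rewrite /enorm dotp0l sqrtr0. Qed.

Lemma enorm0_eq0 u : enorm u = 0 -> u = 0.
Proof. by move=> u0; apply: dotp_eq0; rewrite -enorm_sqr u0 expr0n. Qed.

Lemma enormN u : enorm (- u) = enorm u.
Proof. by rewrite /enorm dotpNl dotpNr opprK. Qed.

Lemma enormB u v : enorm (u - v) = enorm (v - u).
Proof. by rewrite -enormN opprB. Qed.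

Lemma enormZ (a : R) u : enorm (a *: u) = `|a| * enorm u.
Proof.
by rewrite /enorm dotpZl dotpZr mulrA -expr2 sqrtrM ?sqr_ge0// sqrtr_sqr.
Qed.

Lemma dotp_le_enorm u v : dotp u v <= enorm u * enorm v.
Proof.
have [/enorm0_eq0 ->|u0] := eqVneq (enorm u) 0.
  by rewrite dotp0l enorm0 mul0r.
have [/enorm0_eq0 ->|v0] := eqVneq (enorm v) 0.
  by rewrite dotpC dotp0l enorm0 mulr0.
have up : 0 < enorm u by rewrite lt_neqAle eq_sym u0 enorm_ge0.
have vp : 0 < enorm v by rewrite lt_neqAle eq_sym v0 enorm_ge0.
(* Equality in the Cauchy-Schwarz inequality means that |v| u = |u| v. *)
have := dotp_ge0 (enorm v *: u - enorm u *: v).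
rewrite !dotpE -!enorm_sqr (dotpC v u) => h.
rewrite -(ler_pM2l (mulr_gt0 up vp)); move: h; lra.
Qed.

Lemma dotp_young u v : 2 * dotp u v <= dotp u u + dotp v v.
Proof. by have := dotp_ge0 (u - v); rewrite !dotpE (dotpC v u); lra. Qed.

Lemma ler_enormD u v : enorm (u + v) <= enorm u + enorm v.
Proof.
rewrite -(@ler_pXn2r _ 2)// ?nnegrE ?addr_ge0 ?enorm_ge0// sqrrD !enorm_sqr.
by rewrite !dotpE (dotpC v u); have := dotp_le_enorm u v; lra.
Qed.

Lemma ler_enormB u v : enorm u - enorm v <= enorm (u - v).
Proof. by rewrite lerBlDr -{1}(subrK v u) ler_enormD. Qed.

Lemma enorm_sqrD (a : R) u v : 0 < a ->
  enorm (u + v) ^+ 2 <= (1 + a) * enorm u ^+ 2 + (1 + a^-1) * enorm v ^+ 2.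
Proof.
move=> a0; rewrite !enorm_sqr.
have : 0 <= a^-1 * dotp (a *: u - v) (a *: u - v).
  by rewrite mulr_ge0 ?dotp_ge0// invr_ge0 ltW.
rewrite !dotpE (dotpC v u).
have -> : a^-1 * (a * (a * dotp u u + - dotp u v) +
   - (a * dotp u v + - dotp v v)) =
   a * dotp u u - 2 * dotp u v + a^-1 * dotp v v.
  by field; rewrite gt_eqF.
lra.
Qed.

Lemma enorm_sqrD2 u v :
  enorm (u + v) ^+ 2 <= 2 * enorm u ^+ 2 + 2 * enorm v ^+ 2.
Proof. by have := @enorm_sqrD 1 u v ltr01; rewrite invr1. Qed.

Lemma normr_le_enorm u : `|u| <= enorm u.
Proof.
rewrite [leLHS]/Num.norm /= mx_normrE; apply: bigmax_le; first exact: enorm_ge0.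
move=> [i j] _ /=; rewrite ord1 -sqrtr_sqr ler_wsqrtr// /dotp (bigD1 j)//= expr2.
by rewrite lerDl sumr_ge0// => k _; rewrite -expr2 sqr_ge0.
Qed.

Lemma enorm_le_normr u : enorm u <= n%:R * `|u|.
Proof.
rewrite -[leRHS]ger0_norm ?mulr_ge0// -sqrtr_sqr ler_wsqrtr//.
apply: (@le_trans _ _ (\sum_(i < n) `|u| ^+ 2)).
  apply: ler_sum => i _; rewrite -expr2 -real_normK ?num_real//.
  rewrite lerXn2r ?nnegrE//.
  by rewrite [leRHS]/Num.norm /= mx_normrE; apply/bigmax_geP; right; exists (0, i).
rewrite sumr_const card_ord -[leLHS]mulr_natl exprMn.
rewrite ler_wpM2r ?sqr_ge0//.
by rewrite -natrX ler_nat; case: (n) => // k; rewrite expnS leq_pmulr//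
  expn_gt0.
Qed.

(** Existence of minimisers by compactness: sublevel sets of a coercive
    function are bounded.  It provides both the metric projection and the
    fixed points of contractions for the Euclidean norm, for which a
    contraction principle in the sup norm is of no direct use. *)
Lemma coercive_minimizer (A : set 'rV[R]_n) (f : 'rV[R]_n -> R) (c b k : R) :
  A !=set0 -> closed A -> 0 < c -> (forall x, c * enorm x - b <= f x) ->
  (forall x y, f x - f y <= k * enorm (x - y)) ->
  exists2 p, A p & forall q, A q -> f p <= f q.
Proof.
move=> [a Aa] clA c0 coer lip.
have fcont : continuous f.
  move=> x; apply: (iffRL (@cvgrPdist_le _ _ _ (nbhs x) (nbhs_filter x) f _)).
  move=> e e0.
  have K0 : 0 < `|k| * n%:R + 1 by rewrite ltr_wpDl// mulr_ge0.
  have lip' u v : f u - f v <= (`|k| * n%:R + 1) * `|u - v|.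
    rewrite (le_trans (lip _ _))// mulrDl mul1r ler_wpDr// -mulrA.
    apply: le_trans (ler_wpM2r (enorm_ge0 _) (ler_norm k)) _.
    by rewrite ler_wpM2l// enorm_le_normr.
  apply: (iffRL (nbhs_ballP _ _)).
  exists (e / (`|k| * n%:R + 1)) => [|y]; first exact: divr_gt0.
  rewrite mx_norm_ball /= => xy.
  have {}xy : (`|k| * n%:R + 1) * `|x - y| <= e.
    by rewrite mulrC -ler_pdivlMr// ltW.
  rewrite ler_norml lerNl opprB (le_trans (lip' _ _)) /=; last by rewrite distrC.
  by rewrite (le_trans (lip' _ _)).
pose B := A `&` [set x | f x <= f a].
have B0 : B !=set0 by exists a; split=> /=.
have cB : compact B.
  apply: bounded_closed_compact.
    exists ((f a + b) / c); split; first exact: num_real.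
    move=> M aM x [_ /= fx]; rewrite (le_trans (normr_le_enorm x))//.
    rewrite (le_trans _ (ltW aM))// ler_pdivlMr// mulrC.
    by have := coer x; lra.
  apply: closedI => //; apply: (@closed_comp _ _ f [set t | t <= f a]).
    by move=> x _; exact: fcont.
  exact: closed_le.
have [p /set_mem [Ap fpa] minp] :=
  compact_EVT_min B0 cB (continuous_subspaceT fcont).
exists p => // q Aq; have [fq|fq] := leP (f q) (f a).
  by apply: minp; rewrite inE.
exact: le_trans fpa (ltW fq).
Qed.

Lemma contraction_fixpoint (T : 'rV[R]_n -> 'rV[R]_n) (q : R) : q < 1 ->
  (forall x y, enorm (T x - T y) <= q * enorm (x - y)) -> exists x, T x = x.
Proof.
move=> q1 Tq.
have lip x y : enorm (x - T x) - enorm (y - T y) <= (1 + q) * enorm (x - y).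
  apply: le_trans (ler_enormB _ _) _.
  have -> : x - T x - (y - T y) = (x - y) + - (T x - T y).
    by apply/rowP => i; rewrite !mxE; ring.
  by apply: le_trans (ler_enormD _ _) _; rewrite enormN mulrDl mul1r lerD2l.
have coer x : (1 - q) * enorm x - enorm (T 0) <= enorm (x - T x).
  have := Tq x 0; rewrite subr0 => Tx0.
  have := ler_enormB (T x) (T 0); have := ler_enormB x (T x); lra.
have q0 : 0 < 1 - q by rewrite subr_gt0.
have T0 : [set: 'rV[R]_n] !=set0 by exists 0.
have [p _ minp] := coercive_minimizer T0 closedT q0 coer lip.
(* Applying T shortens the displacement p - T p, so it vanishes. *)
have e0 : enorm (p - T p) = 0.
  apply/eqP; rewrite eq_le enorm_ge0 andbT.
  have := le_trans (minp (T p) Logic.I) (Tq p (T p)).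
  rewrite -subr_ge0 -[X in _ - X]mul1r -mulrBl.
  by rewrite nmulr_rge0 ?subr_lt0.
by exists p; apply/esym/eqP; rewrite -subr_eq0; apply/eqP/enorm0_eq0.
Qed.

End EuclideanSpace.

(** * The metric projection and the residual map *)

(* The metric projection, not the coordinate projection of a product. *)
Local Notation proj := Defs.proj.

Section Projection.
Context {R : realType} {n : nat} (X : set 'rV[R]_n).
Hypotheses (X0 : X !=set0) (clX : closed X) (cvX : convex_set X).
Implicit Types (F : 'rV[R]_n -> 'rV[R]_n) (u v w x y : 'rV[R]_n).

Lemma proj_nearest y :
  X (proj X y) /\ forall q, X q -> enorm (y - proj X y) <= enorm (y - q).
Proof.
have coer x : 1 * enorm x - enorm y <= enorm (y - x).
  by rewrite mul1r enormB ler_enormB.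
have lip u v : enorm (y - u) - enorm (y - v) <= 1 * enorm (u - v).
  rewrite mul1r (le_trans (ler_enormB _ _))// enormB.
  by have -> : y - v - (y - u) = u - v by apply/rowP => i; rewrite !mxE; ring.
have [p Xp minp] := coercive_minimizer X0 clX ltr01 coer lip.
by apply: (@xgetPex _ 0 [set p | X p /\ forall q, X q -> _]); exists p.
Qed.

Lemma proj_in y : X (proj X y).
Proof. exact: (proj_nearest y).1. Qed.

(** The nearest point cannot be improved by moving along a segment of X: the
    derivative of the squared distance at the start of the segment is
    nonnegative. *)
Lemma proj_variational y q : X q -> dotp (y - proj X y) (q - proj X y) <= 0.
Proof.
move=> Xq; have [Xp minp] := proj_nearest y; set p := proj X y in Xp minp *.
set a := dotp _ _; set b := dotp (q - p) (q - p).
have b0 : 0 <= b := dotp_ge0 _.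
have quad t : 0 <= t -> t <= 1 -> 2 * t * a <= t ^+ 2 * b.
  move=> t0 t1.
  have Xt : X (t *: q + (1 - t) *: p).
    by have := cvX (Itv01 t0 t1) (mem_set Xq) (mem_set Xp); rewrite inE.
  have := minp _ Xt.
  have -> : y - (t *: q + (1 - t) *: p) = (y - p) - t *: (q - p).
    by apply/rowP => i; rewrite !mxE; ring.
  rewrite -[enorm (y - p) <= _](@ler_pXn2r _ 2)// ?nnegrE ?enorm_ge0//.
  have expand u v : dotp (u - t *: v) (u - t *: v) =
      dotp u u - 2 * t * dotp u v + t ^+ 2 * dotp v v.
    by rewrite !dotpE (dotpC v u); ring.
  by rewrite !enorm_sqr expand -/a -/b; lra.
rewrite leNgt; apply/negP => a0.
have ab : 0 < a + b by lra.
(* At the step t = a / (a + b) the bound reads 2 a <= t b, but t b <= a. *)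
pose t := a / (a + b).
have t0 : 0 < t by rewrite divr_gt0.
have t1 : t <= 1 by rewrite ler_pdivrMr// mul1r lerDl.
have tb : t * b <= a.
  by rewrite mulrAC ler_pdivrMr// mulrDr lerDr mulr_ge0// ltW.
have : 0 < t * (2 * a - t * b) by rewrite mulr_gt0//; lra.
have := quad _ (ltW t0) t1; lra.
Qed.

Lemma proj_firm u v :
  dotp (proj X u - proj X v) (proj X u - proj X v) <=
  dotp (proj X u - proj X v) (u - v).
Proof.
have := proj_variational u (proj_in v); have := proj_variational v (proj_in u).
move: (proj X u) (proj X v) => p q.
by rewrite !dotpE (dotpC v p) (dotpC v q) (dotpC u p) (dotpC u q) (dotpC q p); lra.
Qed.

(** The complement of a firmly nonexpansive map is nonexpansive: noise in the
    operator is not amplified in the residual. *)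
Lemma residual_perturb F1 F2 x eta :
  enorm (residual X F1 x eta - residual X F2 x eta) ^+ 2 <=
  enorm (F1 x - F2 x) ^+ 2.
Proof.
rewrite !enorm_sqr /residual.
have := proj_firm (F1 x - eta *: x) (F2 x - eta *: x).
move: (proj X (F1 x - eta *: x)) (proj X (F2 x - eta *: x)) => p q.
have -> : F1 x - eta *: x - (F2 x - eta *: x) = F1 x - F2 x.
  by apply/rowP => i; rewrite !mxE; ring.
have -> : F1 x - p - (F2 x - q) = (F1 x - F2 x) - (p - q).
  by apply/rowP => i; rewrite !mxE; ring.
move: (F1 x - F2 x) (p - q) => w d.
by have := dotp_ge0 d; rewrite !dotpE (dotpC w d); lra.
Qed.

(* Each variational inequality is tested at the other point: either the shift
   already has the favourable sign, or the two points coincide. *)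
Let shift_nondecreasing u x p p' eta eta' : 0 < eta -> eta <= eta' ->
  dotp (u - eta *: x - p) (p' - p) <= 0 ->
  dotp (u - eta' *: x - p') (p - p') <= 0 ->
  enorm (u - p) ^+ 2 <= enorm (u - p') ^+ 2.
Proof.
move=> eta0 le_eta; rewrite !enorm_sqr.
have -> : p' - p = (u - p) - (u - p').
  by apply/rowP => i; rewrite !mxE; ring.
have -> : p - p' = (u - p') - (u - p).
  by apply/rowP => i; rewrite !mxE; ring.
rewrite (addrAC _ (- (eta *: x))) (addrAC _ (- (eta' *: x))).
move: (u - p) (u - p') => r r' h h'.
have {}h : dotp r r - dotp r r' <= eta * dotp x (r - r').
  by move: h; rewrite !dotpE; lra.
have {}h' : eta' * dotp x (r - r') <= dotp r r' - dotp r' r'.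
  by move: h'; rewrite !dotpE (dotpC r r'); lra.
have d0 := dotp_ge0 (r - r').
have [a0|a0] := leP (dotp x (r - r')) 0.
  by move: d0; rewrite !dotpE (dotpC r' r); nra.
have /dotp_eq0/eqP : dotp (r - r') (r - r') = 0.
  apply/eqP; rewrite eq_le d0 andbT.
  by move: h h' a0; rewrite !dotpE (dotpC r' r); nra.
by rewrite subr_eq0 => /eqP ->.
Qed.

(** The residual is the displacement of F x under a projected step of length
    eta along - x; a longer step cannot produce a shorter displacement. *)
Lemma residual_nondecreasing F x eta eta' : 0 < eta -> eta <= eta' ->
  enorm (residual X F x eta) ^+ 2 <= enorm (residual X F x eta') ^+ 2.
Proof.
move=> eta0 le_eta; apply: shift_nondecreasing eta0 le_eta _ _.
  exact: proj_variational (proj_in _).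
exact: proj_variational (proj_in _).
Qed.

(** The inequality that characterises F x as the projection of F x - eta x is
    the inverse variational inequality multiplied by eta. *)
Lemma residual0_sivi_sol F x eta :
  0 < eta -> residual X F x eta = 0 -> sivi_sol X F x.
Proof.
move=> eta0 /eqP; rewrite subr_eq0 => /eqP Fx.
split=> [|q Xq]; first by rewrite Fx; exact: proj_in.
have := proj_variational (F x - eta *: x) Xq; rewrite -Fx addrAC subrr add0r.
by rewrite dotpNl dotpZl oppr_le0 pmulr_rge0// dotpC.
Qed.

(** Each inequality is tested at the image of the other solution. *)
Lemma sivi_sol_pair F1 F2 a b : sivi_sol X F1 a -> sivi_sol X F2 b ->
  dotp (F1 a - F2 b) (a - b) <= 0.
Proof.
move=> [X1 ha] [X2 hb]; have := ha _ X2; have := hb _ X1.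
by rewrite !dotpE; lra.
Qed.

(** The projection is firmly nonexpansive, so the residual map of an operator
    that is strongly monotone and Lipschitz inherits a strong monotonicity; the
    balance eta m = l between the two constants makes the gradient-like step
    [x - theta * residual] a strict contraction, with a gain proportional to
    the squared difference of the residuals. *)
Lemma residual_contraction F (m l eta theta : R) x y :
  0 < eta -> eta * m = l -> theta * eta = 8^-1 ->
  m * enorm (x - y) ^+ 2 <= dotp (F x - F y) (x - y) ->
  enorm (F x - F y) ^+ 2 <= l * enorm (x - y) ^+ 2 ->
  enorm (x - y - theta *: (residual X F x eta - residual X F y eta)) ^+ 2 <=
  (1 - theta * m) * enorm (x - y) ^+ 2
  - 7 / 8 * (theta / eta)
    * enorm (residual X F x eta - residual X F y eta) ^+ 2.
Proof.
move=> eta0 etam thetaeta; rewrite !enorm_sqr.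
have := proj_firm (F x - eta *: x) (F y - eta *: y).
rewrite /residual.
move: (proj X (F x - eta *: x)) (proj X (F y - eta *: y)) => p q.
have -> : F x - eta *: x - (F y - eta *: y) = (F x - F y) - eta *: (x - y).
  by apply/rowP => i; rewrite !mxE; ring.
have -> : p - q = (F x - F y) - (F x - p - (F y - q)).
  by apply/rowP => i; rewrite !mxE; ring.
move: (F x - F y) (x - y) (_ - (F y - q)) => D d r firm mono lip.
have {}firm : dotp r r + eta * dotp D d - dotp D r <= eta * dotp r d.
  by move: firm; rewrite !dotpE (dotpC r D); lra.
have young := dotp_young D r.
have key : dotp r r + l * dotp d d <= 2 * eta * dotp r d.
  have := ler_wpM2l (ltW eta0) mono; rewrite mulrA etam; lra.
have thetaE : theta = 8^-1 / eta by rewrite -thetaeta mulfK// gt_eqF.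
have mE : m = l / eta by rewrite -etam mulrC mulKf// gt_eqF.
have gain : 0 <= 8^-1 / eta ^+ 2 *
    (2 * eta * dotp r d - l * dotp d d - dotp r r).
  by rewrite mulr_ge0 ?divr_ge0 ?invr_ge0 ?sqr_ge0//; move: key; lra.
have gainE : 8^-1 / eta ^+ 2 *
    (2 * eta * dotp r d - l * dotp d d - dotp r r) =
  (1 - theta * m) * dotp d d - 7 / 8 * (theta / eta) * dotp r r
    - (dotp d d - 2 * theta * dotp r d + theta ^+ 2 * dotp r r).
  by rewrite thetaE mE; field; rewrite gt_eqF.
by move: gain; rewrite gainE !dotpE (dotpC d r); lra.
Qed.

End Projection.

(** * Regularised solutions and one step of the method *)

Section Regularization.
Context {R : realType} {n : nat} (X : set 'rV[R]_n).
Hypotheses (X0 : X !=set0) (clX : closed X) (cvX : convex_set X).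
Variables (F Phi : 'rV[R]_n -> 'rV[R]_n) (L1 L2 mu : R).
Hypotheses (monoF : monotone_map F) (lipF : lipschitz_map L1 F).
Hypotheses (mu0 : 0 < mu) (monoPhi : strongly_monotone_map mu Phi).
Hypothesis lipPhi : lipschitz_map L2 Phi.
Implicit Types (lam eta theta : R) (w x y : 'rV[R]_n).

(** Tikhonov regularisation, with Phi in the role of the identity. *)
Definition regularized lam x := F x + lam *: Phi x.

Let rres lam eta x := residual X (regularized lam) x eta.

Lemma regularized_strongly_monotone lam : 0 <= lam ->
  strongly_monotone_map (lam * mu) (regularized lam).
Proof.
move=> lam0 x y; rewrite /regularized.
have -> : F x + lam *: Phi x - (F y + lam *: Phi y) =
    (F x - F y) + lam *: (Phi x - Phi y).
  by apply/rowP => i; rewrite !mxE; ring.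
rewrite dotpDl dotpZl -mulrA -[leLHS]add0r lerD ?monoF//.
by rewrite ler_wpM2l ?monoPhi.
Qed.

Lemma regularized_lipschitz lam : 0 <= lam -> lam <= 1 ->
  lipschitz_map (L1 + L2) (regularized lam).
Proof.
move=> lam0 lam1 x y; rewrite /regularized.
have -> : F x + lam *: Phi x - (F y + lam *: Phi y) =
    (F x - F y) + lam *: (Phi x - Phi y).
  by apply/rowP => i; rewrite !mxE; ring.
rewrite (le_trans (ler_enormD _ _))// mulrDl lerD ?lipF// enormZ ger0_norm//.
by rewrite (le_trans _ (lipPhi x y))// ler_piMl ?enorm_ge0.
Qed.

(** The balance between eta and lam is the one required by
    [residual_contraction], with the crude Lipschitz constant L1 + L2 of the
    regularised operator for every lam <= 1. *)
Lemma regularized_step lam eta theta x y :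
  0 < lam -> lam <= 1 -> 0 < eta -> eta * (lam * mu) = (L1 + L2) ^+ 2 ->
  theta * eta = 8^-1 ->
  enorm (x - y - theta *: (rres lam eta x - rres lam eta y)) ^+ 2 <=
  (1 - theta * (lam * mu)) * enorm (x - y) ^+ 2
  - 7 / 8 * (theta / eta) * enorm (rres lam eta x - rres lam eta y) ^+ 2.
Proof.
move=> lam0 lam1 eta0 bal theta_eta.
apply: (residual_contraction X0 clX cvX eta0 bal theta_eta).
  exact: regularized_strongly_monotone (ltW lam0) x y.
rewrite -exprMn lerXn2r ?nnegrE ?enorm_ge0//; last first.
  exact: regularized_lipschitz (ltW lam0) lam1 x y.
exact: le_trans (enorm_ge0 _) (regularized_lipschitz (ltW lam0) lam1 x y).
Qed.

Lemma regularized_solution lam eta :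
  0 < lam -> lam <= 1 -> 0 < eta -> eta * (lam * mu) = (L1 + L2) ^+ 2 ->
  exists y, rres lam eta y = 0.
Proof.
move=> lam0 lam1 eta0 bal.
have [theta theta0 theta_eta] : exists2 theta, 0 < theta & theta * eta = 8^-1.
  by exists (8^-1 / eta); rewrite ?divr_gt0 ?invr_gt0// mulfVK// gt_eqF.
pose r := rres lam eta.
pose s := theta * (lam * mu).
have s0 : 0 < s := mulr_gt0 theta0 (mulr_gt0 lam0 mu0).
have q1 : Num.sqrt (1 - s) < 1.
  by rewrite -[ltRHS]sqrtr1 ltr_sqrt ?ltr01// ltrBlDr ltrDl.
have lipT x y : enorm ((x - theta *: r x) - (y - theta *: r y)) <=
    Num.sqrt (1 - s) * enorm (x - y).
  have -> : x - theta *: r x - (y - theta *: r y) =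
      x - y - theta *: (r x - r y).
    by move: (r x) (r y) => ? ?; apply/rowP => i; rewrite !mxE; ring.
  rewrite [leRHS]mulrC -[enorm (x - y)]ger0_norm ?enorm_ge0// -sqrtr_sqr.
  rewrite -sqrtrM ?sqr_ge0// -[leLHS]ger0_norm ?enorm_ge0// -sqrtr_sqr.
  apply: ler_wsqrtr; have := regularized_step x y lam0 lam1 eta0 bal theta_eta.
  rewrite -/(r x) -/(r y) -/s.
  have : 0 <= 7 / 8 * (theta / eta) * enorm (r x - r y) ^+ 2.
    have te0 : 0 <= theta / eta by rewrite divr_ge0// ltW.
    by rewrite mulr_ge0 ?sqr_ge0// mulr_ge0// divr_ge0.
  lra.
have [y Ty] := contraction_fixpoint q1 lipT; exists y.
move/eqP: Ty; rewrite -subr_eq0 addrAC subrr add0r oppr_eq0 scaler_eq0.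
by rewrite gt_eqF//= => /eqP.
Qed.

Lemma enorm_sqr_cancel (a c : R) x : 0 <= c ->
  a * enorm x ^+ 2 <= c * enorm x -> a * enorm x <= c.
Proof.
move=> c0; have [->|x0] := eqVneq (enorm x) 0; first by rewrite !mulr0.
by rewrite expr2 mulrA ler_pM2r// lt_neqAle eq_sym x0 enorm_ge0.
Qed.

(** The regularised and the original inequality tested against each other leave
    only lam times the term in Phi, which is strongly monotone; the bound is
    uniform in lam. *)
Lemma regularized_solution_dist lam xs y : 0 < lam ->
  sivi_sol X F xs -> sivi_sol X (regularized lam) y ->
  mu * enorm (y - xs) <= enorm (Phi xs).
Proof.
move=> lam0 Sxs Sy; apply: enorm_sqr_cancel; first exact: enorm_ge0.
have := sivi_sol_pair Sy Sxs; rewrite /regularized.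
have -> : F y + lam *: Phi y - F xs =
    (F y - F xs) + lam *: (Phi y - Phi xs) + lam *: Phi xs.
  by apply/rowP => i; rewrite !mxE; ring.
move=> h.
rewrite -(ler_pM2l lam0).
have := ler_wpM2l (ltW lam0) (monoPhi y xs); have := monoF y xs.
have := ler_wpM2l (ltW lam0) (dotp_le_enorm (- Phi xs) (y - xs)).
by move: h; rewrite enormN !(dotpDl, dotpNl, dotpZl); lra.
Qed.

(** With lam ~ k ^ (- 1 / 4) the right-hand side divided by lam is of order
    1 / k: this is the speed of the moving target. *)
Lemma regularized_solution_drift lam lam' y y' : 0 < lam -> lam' <= lam ->
  sivi_sol X (regularized lam) y -> sivi_sol X (regularized lam') y' ->
  lam * mu * enorm (y - y') <= (lam - lam') * enorm (Phi y').
Proof.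
move=> lam0 lam'lam Sy Sy'; apply: enorm_sqr_cancel.
  by rewrite mulr_ge0 ?enorm_ge0// subr_ge0.
have := sivi_sol_pair Sy Sy'; rewrite /regularized.
have -> : F y + lam *: Phi y - (F y' + lam' *: Phi y') =
    (F y - F y') + lam *: (Phi y - Phi y') + (lam - lam') *: Phi y'.
  by apply/rowP => i; rewrite !mxE; ring.
move=> h.
have := ler_wpM2l (ltW lam0) (monoPhi y y'); have := monoF y y'.
have ll : 0 <= lam - lam' by rewrite subr_ge0.
have := ler_wpM2l ll (dotp_le_enorm (- Phi y') (y - y')).
by move: h; rewrite enormN !(dotpDl, dotpNl, dotpZl); lra.
Qed.

Lemma regularized_solution_image lam xs y : 0 < lam ->
  sivi_sol X F xs -> sivi_sol X (regularized lam) y ->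
  enorm (Phi y) <= (1 + `|L2| / mu) * enorm (Phi xs).
Proof.
move=> lam0 Sxs Sy; have dist := regularized_solution_dist lam0 Sxs Sy.
rewrite -{1}(subrK (Phi xs) (Phi y)) (le_trans (ler_enormD _ _))//.
rewrite addrC mulrDl mul1r lerD2l (le_trans (lipPhi _ _))//.
apply: le_trans (ler_wpM2r (enorm_ge0 _) (ler_norm L2)) _.
by rewrite -mulrA ler_wpM2l// mulrC ler_pdivlMr// mulrC.
Qed.

(** The distance is measured to the regularised solution [y] before the step
    and to another target [y'] after it; [y'] will be the next regularised
    solution.  Young's inequality absorbs the noise and the move from [y] to
    [y'], each at the price of a factor 1 + s / 2 with s the contraction gain:
    this is affordable because (1 + s / 2) ^ 2 * (1 - s) <= 1. *)
Lemma noisy_step lam eta theta s x y y' w :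
  0 < lam -> lam <= 1 -> 0 < eta -> eta * (lam * mu) = (L1 + L2) ^+ 2 ->
  theta * eta = 8^-1 -> s = theta * (lam * mu) -> rres lam eta y = 0 ->
  enorm (x - theta *: residual X (fun z => regularized lam z + w) x eta - y')
    ^+ 2 <=
  enorm (x - y) ^+ 2
  - 7 / 8 * (theta / eta) * enorm (rres lam eta x) ^+ 2
  + (1 + s / 2) ^+ 2 * (2 / s) * theta ^+ 2 * enorm w ^+ 2
  + (1 + 2 / s) * enorm (y - y') ^+ 2.
Proof.
move=> lam0 lam1 eta0 bal theta_eta sE ry.
have theta0 : 0 < theta by rewrite -(pmulr_lgt0 _ eta0) theta_eta invr_gt0.
have s0 : 0 < s by rewrite sE !mulr_gt0.
set r' := residual X (fun z => _) x eta.
have := regularized_step x y lam0 lam1 eta0 bal theta_eta.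
rewrite ry subr0 -sE; set r := rres lam eta x => contr.
have noise : enorm (r' - r) ^+ 2 <= enorm w ^+ 2.
  have wE : regularized lam x + w - regularized lam x = w.
    by rewrite addrAC subrr add0r.
  rewrite -[in leRHS]wE.
  exact: (residual_perturb X0 clX cvX (fun z => regularized lam z + w)).
pose a := s / 2; have a0 : 0 < a by rewrite divr_gt0.
have aV : a^-1 = 2 / s by rewrite /a invf_div.
have sa : s = 2 * a by rewrite /a mulrC mulfVK.
have -> : x - theta *: r' - y' = (x - theta *: r' - y) + (y - y').
  by move: r' {noise} => r'; apply/rowP => i; rewrite !mxE; ring.
have -> : x - theta *: r' - y = (x - y - theta *: r) + (- theta) *: (r' - r).
  by move: r' r {noise contr} => r' r; apply/rowP => i; rewrite !mxE; ring.
apply: le_trans (enorm_sqrD _ _ a0) _; rewrite aV lerD2r.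
have := enorm_sqrD (x - y - theta *: r) ((- theta) *: (r' - r)) a0.
rewrite enormZ normrN (ger0_norm (ltW theta0)) exprMn aV => split_noise.
have {}contr : enorm (x - y - theta *: r) ^+ 2 <=
    (1 - 2 * a) * enorm (x - y) ^+ 2 - 7 / 8 * (theta / eta) * enorm r ^+ 2.
  by rewrite -sa.
have i0 : 0 < 2 / s by rewrite divr_gt0.
have ai : a * (2 / s) = 1 by rewrite -aV divff// gt_eqF.
have g0 : 0 <= 7 / 8 * (theta / eta) * enorm r ^+ 2.
  have te0 : 0 <= theta / eta by rewrite divr_ge0// ltW.
  by rewrite mulr_ge0 ?sqr_ge0// mulr_ge0// divr_ge0.
have V0 := sqr_ge0 (enorm (x - y)); rewrite -/a.
move: split_noise noise contr i0 ai g0 V0.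
move: (enorm (_ + _) ^+ 2) (enorm (x - y - _) ^+ 2) (7 / 8 * _ * _).
move: (enorm (x - y) ^+ 2) (enorm (r' - r) ^+ 2) (enorm w ^+ 2) (2 / s).
move=> V E W i Q A g split_noise noise contr i0 ai g0 V0.
have i1 : 1 + i = (1 + a) * i by rewrite mulrDl mul1r ai addrC.
rewrite i1 in split_noise.
have a1 : 0 <= 1 + a by rewrite addr_ge0// ltW.
have hQ := ler_wpM2l a1 split_noise.
have hA := ler_wpM2l (sqr_ge0 (1 + a)) contr.
have hE : (1 + a) ^+ 2 * i * theta ^+ 2 * E <= (1 + a) ^+ 2 * i * theta ^+ 2 * W.
  by rewrite ler_wpM2l// !mulr_ge0 ?sqr_ge0// ltW.
have hV : 0 <= (3 * a ^+ 2 + 2 * a ^+ 3) * V.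
  by rewrite mulr_ge0// addr_ge0// mulr_ge0// exprn_ge0// ltW.
have hg : 0 <= (2 * a + a ^+ 2) * g.
  by rewrite mulr_ge0// addr_ge0// ?sqr_ge0// mulr_ge0// ltW.
lra.
Qed.

End Regularization.

(** * Series of powers and integrals *)

Section Series.
Context {R : realType}.

(** This makes the series of t ^ (- (1 + a)) telescope.  The ratio of the two
    powers on the right is the exponential of a (ln (t + 1) - ln t), which is at
    least 1 + a / (t + 1). *)
Lemma powR_decrement (a t : R) : 0 < a -> 0 < t ->
  a * (t + 1) `^ (- (1 + a)) <= t `^ (- a) - (t + 1) `^ (- a).
Proof.
move=> a0 t0; have t1 : 0 < t + 1 by rewrite addr_gt0.
have lnB : (t + 1)^-1 <= ln (t + 1) - ln t.
  have : ln (1 + - (t + 1)^-1) <= - (t + 1)^-1.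
    by apply: le_ln1Dx; rewrite ltrN2 invf_lt1// ltrDr.
  have -> : 1 + - (t + 1)^-1 = t / (t + 1) by field; rewrite gt_eqF.
  by rewrite ln_div ?posrE//; lra.
have -> : (t + 1) `^ (- (1 + a)) = (t + 1)^-1 * (t + 1) `^ (- a).
  rewrite opprD powRD; last by rewrite (gt_eqF t1) implybT.
  by rewrite powR_inv1 ?ltW.
have -> : t `^ (- a) = (t + 1) `^ (- a) * expR (a * (ln (t + 1) - ln t)).
  rewrite /powR (gt_eqF t0) (gt_eqF t1) -expRD; congr expR; ring.
have p0 : 0 <= (t + 1) `^ (- a) := powR_ge0 _ _.
have := ler_wpM2l p0 (expR_ge1Dx (a * (ln (t + 1) - ln t))).
have := ler_wpM2l p0 (ler_wpM2l (ltW a0) lnB); lra.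
Qed.

Lemma sum_powR_le (a : R) (T : nat) : 0 < a ->
  \sum_(k < T) k.+1%:R `^ (- (1 + a)) <= 1 + a^-1.
Proof.
move=> a0; have ai0 : 0 < a^-1 by rewrite invr_gt0.
case: T => [|T]; first by rewrite big_ord0 addr_ge0// ltW.
suff : \sum_(k < T.+1) k.+1%:R `^ (- (1 + a)) <=
    1 + a^-1 * (1 - T.+1%:R `^ (- a)).
  by have := ler_wpM2l (ltW ai0) (powR_ge0 T.+1%:R (- a)); lra.
elim: T => [|T IH].
  by rewrite big_ord_recr big_ord0 /= add0r !powR1 subrr mulr0 addr0.
rewrite big_ord_recr /=.
have := powR_decrement a0 (ltr0Sn R T); rewrite natr1 => dec.
have := ler_wpM2l (ltW ai0) dec; rewrite mulKf ?gt_eqF//; lra.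
Qed.

Lemma sum_invsqrt_le (T : nat) :
  \sum_(k < T) (Num.sqrt k.+1%:R)^-1 <= 2 * Num.sqrt T%:R :> R.
Proof.
elim: T => [|T IH]; first by rewrite big_ord0 mulr_ge0// sqrtr_ge0.
rewrite big_ord_recr /=.
have q0 : 0 <= Num.sqrt T%:R :> R := sqrtr_ge0 _.
have p0 : 0 < Num.sqrt T.+1%:R :> R by rewrite sqrtr_gt0.
have q2 : Num.sqrt T%:R ^+ 2 = T%:R :> R by rewrite sqr_sqrtr.
have p2 : Num.sqrt T.+1%:R ^+ 2 = Num.sqrt T%:R ^+ 2 + 1 :> R.
  by rewrite q2 sqr_sqrtr// natr1.
move: IH q0 p0 p2; move: (Num.sqrt T%:R) (Num.sqrt T.+1%:R) => q p IH q0 p0 p2.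
suff : p^-1 <= 2 * (p - q) by lra.
by rewrite -[p^-1]mul1r ler_pdivrMr//; have := sqr_ge0 (p - q); lra.
Qed.

End Series.

Section LowerIntegral.
Local Open Scope ereal_scope.
Context {d} {T : measurableType d} {R : realType}.
Variable mu : {measure set T -> \bar R}.
Implicit Types f g : T -> \bar R.
Import HBNNSimple.

(** The integral of a nonnegative function is a supremum over the simple
    functions below it.  Hence it is monotone and superadditive whether or not
    the functions are measurable. *)
Lemma ge0_integral_homo f g : (forall x, 0 <= f x) ->
  (forall x, f x <= g x) -> \int[mu]_x f x <= \int[mu]_x g x.
Proof.
move=> f0 fg; have g0 x : 0 <= g x by exact: le_trans (fg x).
rewrite !ge0_integralTE//; apply: ereal_sup_le => _ [h /= hf <-].
by exists h => //= x; exact: le_trans (fg x).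
Qed.

Lemma ge0_integral_superadditive f g :
  (forall x, 0 <= f x) -> (forall x, 0 <= g x) ->
  \int[mu]_x f x + \int[mu]_x g x <= \int[mu]_x (f x + g x).
Proof.
move=> f0 g0; set I := \int[mu]_x (f x + g x).
have fg0 x : 0 <= f x + g x by rewrite adde_ge0.
have [Ioo|Ifin] := eqVneq I +oo; first by rewrite Ioo leey.
have I0 : 0 <= I by exact: integral_ge0.
have {Ifin} Ifin : I \is a fin_num by rewrite ge0_fin_numE// lt_neqAle Ifin leey.
have sub (h1 h2 : {nnsfun T >-> R}) : (forall x, (h1 x)%:E <= f x) ->
    (forall x, (h2 x)%:E <= g x) -> sintegral mu h1 + sintegral mu h2 <= I.
  move=> h1f h2g; rewrite -sintegralD// /I ge0_integralTE//.
  apply: ereal_sup_ubound; exists (add_nnsfun h1 h2) => //= x.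
  by rewrite EFinD leeD.
have z0 : sintegral mu (@nnsfun0 _ T R) = 0 by rewrite sintegral0.
have fin_sint (h : {nnsfun T >-> R}) : (forall x, (h x)%:E <= g x) ->
    sintegral mu h \is a fin_num.
  move=> hg; rewrite ge0_fin_numE ?sintegral_ge0//.
  apply: (@le_lt_trans _ _ I); last by rewrite ltey_eq Ifin.
  by rewrite -[leLHS]add0e -z0 sub.
have subf (h : {nnsfun T >-> R}) : (forall x, (h x)%:E <= g x) ->
    \int[mu]_x f x + sintegral mu h <= I.
  move=> hg; rewrite -leeBrDr ?fin_sint// [X in X <= _]ge0_integralTE//.
  by apply: ge_ereal_sup => _ [h' /= h'f <-]; rewrite leeBrDr ?fin_sint ?sub.
have fin_f : \int[mu]_x f x \is a fin_num.
  rewrite ge0_fin_numE ?integral_ge0//.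
  apply: (@le_lt_trans _ _ I); last by rewrite ltey_eq Ifin.
  by rewrite -[leLHS]adde0 -z0 subf.
rewrite addeC -leeBrDr// [X in X <= _]ge0_integralTE//.
apply: ge_ereal_sup => _ [h /= hg <-].
by rewrite leeBrDr// addeC subf.
Qed.

(** By superadditivity the integrals of the summands add up to at most the
    integral of the bound, and the minimum is at most their average. *)
Lemma mine_integral_le_avg (h : nat -> T -> R) (B : T -> R) (n : nat) :
  (forall k x, 0 <= h k x)%R -> (forall x, \sum_(k < n) h k x <= B x)%R ->
  n%:R%:E * \big[mine/+oo]_(k < n) \int[mu]_x (h k x)%:E <=
  \int[mu]_x (B x)%:E.
Proof.
move=> h0 hB; set m := \big[mine/+oo]_(k < n) _.
have m_le k : (k < n)%N -> m <= \int[mu]_x (h k x)%:E.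
  by move=> kn; rewrite /m (bigD1 (Ordinal kn))//= ge_min lexx.
suff sum_le j : (j <= n)%N ->
    j%:R%:E * m <= \int[mu]_x (\sum_(k < j) h k x)%:E.
  apply: le_trans (sum_le _ (leqnn n)) _.
  by apply: ge0_integral_homo => x; rewrite lee_fin// sumr_ge0.
elim: j => [_|j IH jn].
  by rewrite mul0e integral_ge0// => x _; rewrite big_ord0.
rewrite -natr1 EFinD ge0_muleDl ?lee_fin// mul1e.
apply: le_trans (leeD (IH (ltnW jn)) (m_le _ jn)) _.
apply: le_trans (ge0_integral_superadditive _ _) _.
- by move=> x; rewrite lee_fin sumr_ge0.
- by move=> x; rewrite lee_fin.
- by under [leRHS]eq_integral do rewrite big_ord_recr EFinD.
Qed.

End LowerIntegral.

Section Expectation.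
Context {R : realType} {d} {Omega : measurableType d}.
Variable P : probability Omega R.

(** The mean of Z is the mean of Y, and the almost sure bound passes to the
    mean through the positive part of Y. *)
Lemma cond_exp_mean_le (A : set (set Omega)) (Z Y : Omega -> R) (c : R) :
  A setT -> is_cond_exp P A Z Y -> 0 <= c -> {ae P, forall w, Y w <= c} ->
  (\int[P]_w (Z w)%:E <= c%:E)%E.
Proof.
move=> AT [_ /integrableP[mY _] _ /(_ _ AT) ->] c0 Yc.
rewrite integralE (@le_trans _ _ (\int[P]_w ((EFin \o Y)^\+ w)))%E//.
  by rewrite -[leRHS]sube0 leeB// integral_ge0.
apply: (@le_trans _ _ (\int[P]_w (cst c%:E w))%E); last first.
  by rewrite integral_cst// [X in (_ * X)%E]probability_setT mule1.
apply: ae_ge0_le_integral => //.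
  exact: measurable_funepos.
by apply: filterS Yc => w Yc _; rewrite unlock /= ge_max !lee_fin Yc.
Qed.

Lemma affine_mean_le (W : nat -> Omega -> R) (v : nat -> R) (A B : R) (T : nat) :
  0 <= A -> 0 <= B -> (forall k w, 0 <= W k w) ->
  (forall k, measurable_fun setT (EFin \o W k)) ->
  (forall k, \int[P]_w (W k w)%:E <= (v k)%:E)%E ->
  (\int[P]_w (A * (\sum_(k < T) W k w) + B)%:E <=
     (A * (\sum_(k < T) v k) + B)%:E)%E.
Proof.
move=> A0 B0 W0 mW Wv.
have sumE w : ((\sum_(k < T) W k w)%:E = \sum_(k < T) (EFin \o W k) w)%E.
  by rewrite sumEFin.
under eq_integral do rewrite EFinD EFinM sumE.
have mS : measurable_fun setT (fun w => \sum_(k < T) (EFin \o W k) w)%E.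
  exact: emeasurable_sum.
have S0 w : (0 <= \sum_(k < T) (EFin \o W k) w)%E.
  by apply: sume_ge0 => k _; rewrite /= lee_fin.
rewrite ge0_integralD//=; last 2 first.
- by move=> w _; apply: mule_ge0; [rewrite lee_fin|exact: S0].
- exact: measurable_funeM.
have BE : (\int[P]_w B%:E = B%:E)%E.
  have := integral_cst P measurableT B%:E.
  by rewrite [X in (_ * X)%E]probability_setT mule1.
rewrite ge0_integralZl_EFin//; last by move=> w _; exact: S0.
rewrite BE EFinD leeD2r// EFinM lee_wpmul2l ?lee_fin//.
rewrite ge0_integral_sum//; last 2 first.
- by move=> k; exact: mW.
- by move=> k w _; rewrite lee_fin.
by rewrite -sumEFin; apply: lee_sum => k _; exact: Wv.
Qed.

End Expectation.

(** * Summation along a path *)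

Section FourthRoots.
Context {R : realType}.

Definition root4 (k : nat) : R := k.+1%:R `^ (1 / 4).

Lemma root4_gt0 k : 0 < root4 k.
Proof. exact: powR_gt0. Qed.

Lemma root4X k : root4 k ^+ 4 = k.+1%:R.
Proof. by rewrite -powR_mulrn ?powR_ge0// -powRrM mul1r mulVf// powRr1. Qed.

Lemma root4_ge1 k : 1 <= root4 k.
Proof.
rewrite -(@ler_pXn2r _ 4)// ?nnegrE ?(ltW (root4_gt0 k))//.
by rewrite root4X expr1n ler1n.
Qed.

Lemma root4V k : k.+1%:R `^ (- (1 / 4)) = (root4 k)^-1.
Proof. exact: powRN. Qed.

Lemma root4_sqr k : root4 k ^+ 2 = Num.sqrt k.+1%:R.
Proof. by rewrite -root4X -[4%N]/(2 * 2)%N exprM sqrtr_sqr ger0_norm// sqr_ge0. Qed.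

Lemma root4_Vexp6 k : k.+1%:R `^ (- (1 + 2^-1)) = (root4 k ^+ 6)^-1.
Proof.
rewrite powRN powRD ?pnatr_eq0 ?implybT// powRr1// powR12_sqrt// -root4_sqr.
by rewrite -{1}root4X -exprD.
Qed.

(** A number of [0, 1] is at least its fourth power. *)
Lemma root4_ratio k : 1 - root4 k / root4 k.+1 <= (root4 k ^+ 4)^-1.
Proof.
have b0 := root4_gt0 k; have b1 := root4_gt0 k.+1.
have bb : root4 k.+1 ^+ 4 = root4 k ^+ 4 + 1 by rewrite !root4X natr1.
have q0 : 0 <= root4 k / root4 k.+1 by rewrite divr_ge0// ltW.
have q1 : root4 k / root4 k.+1 <= 1.
  rewrite ler_pdivrMr// mul1r -(@ler_pXn2r _ 4)// ?nnegrE ?(ltW b0) ?(ltW b1)//.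
  by rewrite bb lerDl.
have q4 : (root4 k / root4 k.+1) ^+ 4 <= root4 k / root4 k.+1.
  by rewrite exprS ler_piMr// exprn_ile1.
have t0 : 0 < root4 k ^+ 4 by rewrite exprn_gt0.
have : 1 - (root4 k / root4 k.+1) ^+ 4 <= (root4 k ^+ 4)^-1; last by lra.
rewrite expr_div_n bb.
have -> : 1 - root4 k ^+ 4 / (root4 k ^+ 4 + 1) = (root4 k ^+ 4 + 1)^-1.
  by field; rewrite gt_eqF// addr_gt0.
by rewrite lef_pV2 ?posrE ?addr_gt0// lerDl.
Qed.

End FourthRoots.

Section Paths.
Context {R : realType} {n : nat} (X : set 'rV[R]_n).
Hypotheses (X0 : X !=set0) (clX : closed X) (cvX : convex_set X).
Variables (F Phi : 'rV[R]_n -> 'rV[R]_n) (L1 L2 mu : R).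
Hypotheses (monoF : monotone_map F) (lipF : lipschitz_map L1 F).
Hypotheses (mu0 : 0 < mu) (monoPhi : strongly_monotone_map mu Phi).
Hypothesis lipPhi : lipschitz_map L2 Phi.
Variable xs : 'rV[R]_n.
Hypothesis Sxs : sivi_sol X F xs.
Let C1 : R := (L1 + L2) ^+ 2 / mu.
Let C2 : R := 1 / (8 * C1).
Hypothesis C1_gt0 : 0 < C1.

Let lambda k : R := k.+1%:R `^ (- (1 / 4)).
Let eta k : R := C1 * k.+1%:R `^ (1 / 4).
Let theta k : R := C2 * k.+1%:R `^ (- (1 / 4)).
Let rF k := regularized F Phi (lambda k).

Let C2_gt0 : 0 < C2.
Proof. by rewrite divr_gt0// mulr_gt0. Qed.

Let lambdaE k : lambda k = (root4 k)^-1. Proof. exact: root4V. Qed.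
Let etaE k : eta k = C1 * root4 k. Proof. by []. Qed.
Let thetaE k : theta k = C2 / root4 k. Proof. by rewrite /theta root4V. Qed.

Let lambda_gt0 k : 0 < lambda k. Proof. exact: powR_gt0. Qed.
Let eta_gt0 k : 0 < eta k. Proof. by rewrite mulr_gt0// root4_gt0. Qed.

Let lambda_le1 k : lambda k <= 1.
Proof. by rewrite lambdaE invf_le1 ?root4_gt0// root4_ge1. Qed.

Let eta_lambda k : eta k * (lambda k * mu) = (L1 + L2) ^+ 2.
Proof.
rewrite etaE lambdaE /C1; field.
by rewrite !gt_eqF ?root4_gt0.
Qed.

Let theta_eta k : theta k * eta k = 8^-1.
Proof.
rewrite etaE thetaE /C2; field.
by rewrite !gt_eqF ?root4_gt0.
Qed.

Let s0 := C2 * mu.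
Let s0_gt0 : 0 < s0. Proof. exact: mulr_gt0. Qed.

Let M := (1 + `|L2| / mu) * enorm (Phi xs).

(** The descent inequality for the squared distance to the moving regularised
    solutions.  With the given parameters the gain of the residual is of order
    k ^ (- 1 / 2), the drift contributes a summable k ^ (- 3 / 2), and the
    coefficient of the noise is bounded. *)
Let descent (y : nat -> 'rV[R]_n) k x w :
  (forall j, residual X (rF j) (y j) (eta j) = 0) ->
  enorm (x - theta k *: residual X (fun z => rF k z + w) x (eta k) - y k.+1)
    ^+ 2 <=
  enorm (x - y k) ^+ 2
  - 7 / 8 * (C2 / C1)
    * ((Num.sqrt k.+1%:R)^-1 * enorm (residual X (rF k) x (eta k)) ^+ 2)
  + (1 + s0 / 2) ^+ 2 * (2 * C2 / mu) * enorm w ^+ 2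
  + (1 + 2 / s0) * (M / mu) ^+ 2 * k.+1%:R `^ (- (1 + 2^-1)).
Proof.
move=> ry.
have b0 : 0 < root4 k :> R := root4_gt0 k.
have b1 : 1 <= root4 k :> R := root4_ge1 k.
have Sy j : sivi_sol X (rF j) (y j).
  exact: (residual0_sivi_sol X0 clX cvX (eta_gt0 j) (ry j)).
have sE : s0 / root4 k ^+ 2 = theta k * (lambda k * mu).
  by rewrite thetaE lambdaE /s0; field; rewrite gt_eqF.

have step := noisy_step X0 clX cvX monoF lipF mu0 monoPhi lipPhi x (y k.+1) w
  (lambda_gt0 k) (lambda_le1 k) (eta_gt0 k) (eta_lambda k) (theta_eta k)
  sE (ry k).
apply: le_trans step _.
have drift : enorm (y k - y k.+1) <= (root4 k ^+ 4)^-1 * (M / mu).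
  have lam_dec : lambda k.+1 <= lambda k.
    rewrite !lambdaE lef_pV2 ?posrE ?root4_gt0//.
    rewrite -(@ler_pXn2r _ 4)// ?nnegrE ?(ltW (root4_gt0 _))//.
    by rewrite !root4X ler_nat.
  have := regularized_solution_drift monoF monoPhi (lambda_gt0 k) lam_dec
    (Sy k) (Sy k.+1).
  have image := regularized_solution_image monoF mu0 monoPhi lipPhi
    (lambda_gt0 k.+1) Sxs (Sy k.+1).
  have ll : 0 <= lambda k - lambda k.+1 by rewrite subr_ge0.
  move=> /le_trans /(_ (ler_wpM2l ll image)); rewrite -/M => h.
  have M0 : 0 <= M := le_trans (enorm_ge0 _) image.
  have {}h : enorm (y k - y k.+1) <= (1 - root4 k / root4 k.+1) * (M / mu).
    rewrite -(ler_pM2l (mulr_gt0 (lambda_gt0 k) mu0)) (le_trans h)//.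
    rewrite !lambdaE le_eqVlt; apply/orP; left; apply/eqP; field.
    by rewrite !gt_eqF ?root4_gt0.
  by rewrite (le_trans h)// ler_wpM2r ?root4_ratio// divr_ge0// ltW.
have {}drift : enorm (y k - y k.+1) ^+ 2 <= (root4 k ^+ 4) ^- 2 * (M / mu) ^+ 2.
  rewrite -exprVn -exprMn lerXn2r ?nnegrE ?enorm_ge0//.
  exact: le_trans (enorm_ge0 _) drift.
rewrite root4_Vexp6 -root4_sqr.
rewrite lerD//; last first.
  have -> : 2 / (s0 / root4 k ^+ 2) = 2 / s0 * root4 k ^+ 2.
    by field; rewrite !gt_eqF.
  have i0 : 0 <= 2 / s0 by rewrite divr_ge0// ltW.
  have b2 : 1 <= root4 k ^+ 2 :> R by rewrite exprn_ege1.
  apply: (@le_trans _ _ ((1 + 2 / s0) * root4 k ^+ 2 *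
      ((root4 k ^+ 4) ^- 2 * (M / mu) ^+ 2))).
    apply: ler_pM => //; rewrite ?sqr_ge0//.
      by rewrite addr_ge0// mulr_ge0// sqr_ge0.
    by move: (2 / s0) (root4 k ^+ 2) b2 => i B; lra.
  rewrite le_eqVlt; apply/orP; left; apply/eqP; field.
  by rewrite !gt_eqF.
rewrite lerD//; last first.
  rewrite ler_wpM2r ?sqr_ge0//.
  have -> : (1 + s0 / root4 k ^+ 2 / 2) ^+ 2 * (2 / (s0 / root4 k ^+ 2)) *
      theta k ^+ 2 = (1 + s0 / root4 k ^+ 2 / 2) ^+ 2 * (2 * C2 / mu).
    by rewrite thetaE /s0; field; rewrite !gt_eqF.
  rewrite ler_wpM2r//; first by rewrite divr_ge0 ?ltW// mulr_gt0.
  have sb0 : 0 <= s0 / root4 k ^+ 2 by rewrite divr_ge0 ?sqr_ge0// ltW.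
  have sb : s0 / root4 k ^+ 2 <= s0.
    by rewrite ler_pdivrMr ?exprn_gt0// ler_peMr ?(ltW s0_gt0)// exprn_ege1.
  rewrite lerXn2r ?nnegrE ?addr_ge0 ?divr_ge0 ?sqr_ge0// ?(ltW s0_gt0)//.
  by rewrite lerD2l ler_wpM2r.
rewrite lerD2l lerN2 le_eqVlt; apply/orP; left; apply/eqP.
rewrite thetaE etaE; move: (enorm _) => h; field.
by rewrite !gt_eqF.
Qed.

(** The residual of F itself at a fixed parameter is controlled by the
    regularised residual at the larger parameter eta k, up to the
    regularisation term. *)
Let residual_unregularize (y : nat -> 'rV[R]_n) (etabar : R) k x :
  (forall j, residual X (rF j) (y j) (eta j) = 0) ->
  0 < etabar -> etabar <= C1 ->
  enorm (residual X F x etabar) ^+ 2 <=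
  2 * enorm (residual X (rF k) x (eta k)) ^+ 2
  + (Num.sqrt k.+1%:R)^-1 * (4 * M ^+ 2 + 4 * L2 ^+ 2 * enorm (x - y k) ^+ 2).
Proof.
move=> ry e0 eC1.
have Sy : sivi_sol X (rF k) (y k).
  exact: (residual0_sivi_sol X0 clX cvX (eta_gt0 k) (ry k)).
have le_eta : etabar <= eta k.
  by rewrite (le_trans eC1)// etaE ler_peMr ?(ltW C1_gt0)// root4_ge1.
apply: le_trans (residual_nondecreasing X0 clX cvX F x e0 le_eta) _.
rewrite -[residual X F x (eta k)](subrK (residual X (rF k) x (eta k))) addrC.
apply: le_trans (enorm_sqrD2 _ _) _; rewrite lerD2l.
have perturb := residual_perturb X0 clX cvX F (rF k) x (eta k).
have rFE : enorm (F x - rF k x) ^+ 2 =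
    (Num.sqrt k.+1%:R)^-1 * enorm (Phi x) ^+ 2.
  rewrite /rF /regularized opprD addrA subrr add0r enormN enormZ exprMn.
  by rewrite ger0_norm ?ltW// lambdaE exprVn root4_sqr.
rewrite rFE in perturb.
have PhiE : enorm (Phi x) ^+ 2 <=
    2 * M ^+ 2 + 2 * (L2 ^+ 2 * enorm (x - y k) ^+ 2).
  rewrite -[Phi x](subrK (Phi (y k))) addrC.
  apply: le_trans (enorm_sqrD2 _ _) _.
  have image := regularized_solution_image monoF mu0 monoPhi lipPhi
    (lambda_gt0 k) Sxs Sy.
  rewrite -exprMn lerD// ler_wpM2l// lerXn2r ?nnegrE ?enorm_ge0//.
  - exact: le_trans (enorm_ge0 _) image.
  - exact: le_trans (enorm_ge0 _) (lipPhi _ _).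
have t0 : 0 <= (Num.sqrt k.+1%:R)^-1 :> R by rewrite invr_ge0 sqrtr_ge0.
have := ler_wpM2l t0 PhiE; move: perturb; lra.
Qed.

(** The constants do not depend on the noise w, so the estimate can be
    integrated over all paths.  The two contributions to the squared residuals
    sum to order sqrt T: the regularised residuals because their weights
    k ^ (- 1 / 2) are at least T ^ (- 1 / 2), the regularisation terms because
    the sum of k ^ (- 1 / 2) is at most 2 sqrt T. *)
Lemma residual_path_sum (x0 : 'rV[R]_n) (etabar : R) :
  0 < etabar -> etabar <= C1 ->
  exists A B : R, [/\ 0 <= A, 0 <= B &
    forall x w : nat -> 'rV[R]_n, x 0%N = x0 ->
    (forall k, x k.+1 = x k
       - theta k *: residual X (fun z => rF k z + w k) (x k) (eta k)) ->
    forall T, \sum_(k < T) enorm (residual X F (x k) etabar) ^+ 2 <=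
      Num.sqrt T%:R * (A * \sum_(k < T) enorm (w k) ^+ 2 + B)].
Proof.
move=> e0 eC1.
have /choice[y ry] : forall j, exists yj, residual X (rF j) yj (eta j) = 0.
  by move=> j; apply: (regularized_solution X0 clX cvX monoF lipF mu0 monoPhi
    lipPhi (lambda_gt0 j) (lambda_le1 j) (eta_gt0 j) (eta_lambda j)).
set c1 := 7 / 8 * (C2 / C1).
set c2 := (1 + s0 / 2) ^+ 2 * (2 * C2 / mu).
set c3 := (1 + 2 / s0) * (M / mu) ^+ 2.
have c1_gt0 : 0 < c1.
  by apply: mulr_gt0; [rewrite divr_gt0|exact: divr_gt0 C2_gt0 C1_gt0].
have c2_ge0 : 0 <= c2.
  by rewrite /c2 mulr_ge0 ?sqr_ge0// divr_ge0 ?(ltW mu0)// mulr_ge0// ltW.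
have c3_ge0 : 0 <= c3.
  by rewrite /c3 mulr_ge0 ?sqr_ge0// addr_ge0// divr_ge0// ltW.
pose D := enorm (x0 - y 0%N) ^+ 2 + 3 * c3.
have D0 : 0 <= D by rewrite /D addr_ge0 ?sqr_ge0// mulr_ge0.
have K0 : 0 <= 2 / c1 + 8 * L2 ^+ 2.
  by rewrite addr_ge0 ?divr_ge0 ?(ltW c1_gt0)// mulr_ge0 ?sqr_ge0.
exists ((2 / c1 + 8 * L2 ^+ 2) * c2), ((2 / c1 + 8 * L2 ^+ 2) * D + 8 * M ^+ 2).
split=> [||x w x_0 xS T]; first exact: mulr_ge0.
  by apply: addr_ge0; rewrite mulr_ge0// sqr_ge0.
pose g k := (Num.sqrt k.+1%:R)^-1
  * enorm (residual X (rF k) (x k) (eta k)) ^+ 2.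
have g0 k : 0 <= g k by rewrite /g mulr_ge0 ?sqr_ge0// invr_ge0 sqrtr_ge0.
pose W j := \sum_(k < j) enorm (w k) ^+ 2.
have telescope j : enorm (x j - y j) ^+ 2 + c1 * \sum_(k < j) g k <=
    enorm (x0 - y 0%N) ^+ 2 + c2 * W j
    + c3 * \sum_(k < j) k.+1%:R `^ (- (1 + 2^-1)).
  elim: j => [|j IH]; first by rewrite /W !big_ord0 !mulr0 !addr0 x_0.
  have := descent j (x j) (w j) ry; rewrite -xS -/(g j) -/c1 -/c2 -/c3.
  rewrite /W !big_ord_recr /= -/(W j) !mulrDr.
  by move: IH; lra.
pose S := D + c2 * W T.
have W_le j : (j <= T)%N -> W j <= W T.
  move=> jT; rewrite /W -!(big_mkord xpredT (fun k => enorm (w k) ^+ 2)).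
  rewrite [leRHS](@big_cat_nat _ _ _ j)//= lerDl.
  by apply: sumr_ge0 => k _; rewrite sqr_ge0.
have bound j : (j <= T)%N -> enorm (x j - y j) ^+ 2 + c1 * \sum_(k < j) g k <= S.
  move=> jT; apply: le_trans (telescope j) _.
  have := ler_wpM2l c3_ge0 (@sum_powR_le R 2^-1 j _); rewrite invr_gt0 ltr0n.
  move=> /(_ isT); have := ler_wpM2l c2_ge0 (W_le _ jT).
  by rewrite /S /D invrK; lra.
have sum_g : \sum_(k < T) g k <= S / c1.
  rewrite ler_pdivlMr// mulrC.
  by have := bound T (leqnn T); have := sqr_ge0 (enorm (x T - y T)); lra.
have dist k : (k <= T)%N -> enorm (x k - y k) ^+ 2 <= S.
  move=> kT; have := bound k kT.
  have : 0 <= c1 * \sum_(k0 < k) g k0 by rewrite mulr_ge0 ?(ltW c1_gt0) ?sumr_ge0.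
  lra.
have S0 : 0 <= S by exact: le_trans (sqr_ge0 _) (dist 0%N _).
pose E := 4 * M ^+ 2 + 4 * L2 ^+ 2 * S.
have L0 : 0 <= 4 * L2 ^+ 2 by rewrite mulr_ge0// sqr_ge0.
have E0 : 0 <= E by apply: addr_ge0; rewrite mulr_ge0// sqr_ge0.
apply: (@le_trans _ _ (\sum_(k < T) (2 * Num.sqrt T%:R * g k
    + (Num.sqrt k.+1%:R)^-1 * E))).
  apply: ler_sum => k _.
  apply: le_trans (residual_unregularize k (x k) ry e0 eC1) _.
  have t0 : 0 < Num.sqrt k.+1%:R :> R by rewrite sqrtr_gt0.
  rewrite lerD//.
    rewrite -mulrA ler_wpM2l// /g mulrA ler_peMl ?sqr_ge0//.
    by rewrite ler_pdivlMr// mul1r ler_wsqrtr// ler_nat.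
  by rewrite ler_wpM2l ?invr_ge0 ?(ltW t0)// lerD2l ler_wpM2l// dist// ltnW.
rewrite big_split /= -mulr_sumr -mulr_suml.
have T0 : 0 <= Num.sqrt T%:R :> R := sqrtr_ge0 _.
have := ler_wpM2r E0 (@sum_invsqrt_le R T).
have := ler_wpM2l T0 sum_g.
rewrite -/(W T) => h1 h2.
have -> : (2 / c1 + 8 * L2 ^+ 2) * c2 * W T +
    ((2 / c1 + 8 * L2 ^+ 2) * D + 8 * M ^+ 2) = 2 * (S / c1) + 2 * E.
  by rewrite /E /S; ring.
by move: h1 h2; lra.
Qed.

End Paths.

(** * Taking expectations *)

Lemma history_setT (R : realType) (n d : nat) (d0 : measure_display)
    (Omega : measurableType d0) (x0 : 'rV[R]_n) (N : nat -> nat)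
    (xis : nat -> nat -> Omega -> borel R d) (k : nat) :
  history x0 N xis k setT.
Proof.
have [h0 hD _] := smallest_sigma_algebra setT
  (g_sigma_algebra_preimage (cst x0 : Omega -> borel R n)
   `|` \bigcup_(s < k) \bigcup_(j < N s) g_sigma_algebra_preimage (xis s j)).
by have := hD _ h0; rewrite setD0.
Qed.

Lemma hatF_regularized (R : realType) (n d : nat) (d0 : measure_display)
    (Omega : measurableType d0) (G : 'rV[R]_n -> 'rV[R]_d -> 'rV[R]_n)
    (F Phi : 'rV[R]_n -> 'rV[R]_n) (lambda : nat -> R) (N : nat -> nat)
    (xis : nat -> nat -> Omega -> borel R d) (x : nat -> Omega -> 'rV[R]_n)
    (k : nat) (w : Omega) : (0 < N k)%N ->
  hatF G Phi lambda N xis x k w =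
  regularized F Phi (lambda k) (x k w) + avg_error F G N xis x k w.
Proof.
move=> Nk; rewrite /hatF /regularized /avg_error addrAC; congr (_ + _).
rewrite big_split /= sumr_const card_ord scalerDr.
rewrite mulNrn scalerN -[F _ *+ _]scaler_nat scalerA mulVf ?pnatr_eq0 -?lt0n//.
by rewrite scale1r addrC subrK.
Qed.

Lemma ceil_powR_ge (R : realType) (t a : R) : 0 <= t ->
  t `^ a <= `|Num.ceil (t `^ a)|%N%:R.
Proof.
move=> t0; rewrite natr_absz ger0_norm ?ceil_ge//.
by rewrite ceil_ge0 (lt_le_trans _ (powR_ge0 _ _)).
Qed.

Theorem corollary2 (R : realType) (n d : nat)
    (d0 : measure_display) (Omega : measurableType d0)
    (P : probability Omega R)
    (X : set 'rV[R]_n)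
    (xi : {RV P >-> borel R d})
    (G : 'rV[R]_n -> 'rV[R]_d -> 'rV[R]_n)
    (Phi : 'rV[R]_n -> 'rV[R]_n)
    (L1 L2 mu delta etabar : R)
    (x0 : 'rV[R]_n)
    (xis : nat -> nat -> {RV P >-> borel R d})
    (x : nat -> Omega -> 'rV[R]_n) :
  let F := mean_map P G xi in
  let C1 := (L1 + L2) ^+ 2 / mu in
  let C2 := 1 / (8 * C1) in
  let lambda := fun k : nat => k.+1%:R `^ (- (1 / 4)) : R in
  let eta := fun k : nat => C1 * k.+1%:R `^ (1 / 4) in
  let theta := fun k : nat => C2 * k.+1%:R `^ (- (1 / 4)) in
  let N := fun k : nat => `|Num.ceil (k.+1%:R `^ (1 + delta) : R)|%N in
  X !=set0 -> closed X -> convex_set X ->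
  measurable_fun [set: borel R n * borel R d]
    (fun p : borel R n * borel R d => G p.1 p.2 : borel R n) ->
  (forall (y : 'rV[R]_n) (i : 'I_n),
     P.-integrable setT (EFin \o (fun w => G y (xi w) 0 i))) ->
  monotone_map F -> lipschitz_map L1 F ->
  0 < mu -> strongly_monotone_map mu Phi -> lipschitz_map L2 Phi ->
  sivi_sol X F !=set0 ->
  0 < delta ->
  (forall k j, (j < N k)%N -> same_distribution P (xis k j) xi) ->
  rvc_ipg X G Phi x0 eta theta lambda N xis x ->
  stochastic_error_assumption P F G x0 N xis x ->
  0 < etabar -> etabar <= C1 ->
  exists2 K : R, 0 < K & forall T : nat, (0 < T)%N ->
    (\big[mine/+oo]_(k < T)
        'E_P[fun w => (enorm (residual X F (x k w) etabar) ^+ 2)%R]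
     <= (K / Num.sqrt T%:R)%:E)%E.
Proof.
move=> F C1 C2 lambda eta theta N X0 clX cvX _ _ monoF lipF mu0 monoPhi lipPhi
  [xs Sxs] delta0 _ [xinit xstep] [nu nu0 err] e0 eC1.
have C1_gt0 : 0 < C1 by exact: lt_le_trans eC1.
have [A [B [A0 B0 path]]] := residual_path_sum X0 clX cvX monoF lipF mu0
  monoPhi lipPhi Sxs C1_gt0 x0 e0 eC1.
have N_ge k : k.+1%:R `^ (1 + delta) <= (N k)%:R :> R by exact: ceil_powR_ge.
have N_gt0 k : (0 < N k)%N.
  by rewrite -(ltr0n R) (lt_le_trans _ (N_ge k))// powR_gt0.
pose W k w := enorm (avg_error F G N xis x k w) ^+ 2.
pose v k : R := nu ^+ 2 * k.+1%:R `^ (- (1 + delta)).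
have mean_W k : (\int[P]_w (W k w)%:E <= (v k)%:E)%E.
  have [_ [Y condY Yle]] := err k.
  have HT : history x0 N xis k setT by exact: history_setT.
  have c0 : 0 <= nu ^+ 2 / (N k)%:R by rewrite divr_ge0 ?sqr_ge0.
  have := cond_exp_mean_le HT condY c0 Yle.
  move=> /le_trans; apply.
  rewrite lee_fin /v powRN ler_wpM2l ?sqr_ge0// lef_pV2 ?posrE ?powR_gt0//.
  by rewrite ltr0n.
have mW k : measurable_fun setT (EFin \o W k).
  by have [_ [Y [/integrableP[]]]] := err k.
have sum_v T : \sum_(k < T) v k <= nu ^+ 2 * (1 + delta^-1).
  by rewrite -mulr_sumr ler_wpM2l ?sqr_ge0// sum_powR_le.
pose K := A * (nu ^+ 2 * (1 + delta^-1)) + B.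
have K0 : 0 <= K.
  apply: addr_ge0 B0; apply: mulr_ge0 A0 _; rewrite mulr_ge0 ?sqr_ge0//.
  by rewrite addr_ge0// invr_ge0 ltW.
exists (K + 1) => [|T T0]; first by rewrite ltr_wpDl.
have T0' : 0 < T%:R :> R by rewrite ltr0n.
have sT0 : 0 < Num.sqrt T%:R :> R by rewrite sqrtr_gt0.
pose h k w := enorm (residual X F (x k w) etabar) ^+ 2.
have h_sum w : \sum_(k < T) h k w <=
    (Num.sqrt T%:R * A) * (\sum_(k < T) W k w) + Num.sqrt T%:R * B.
  rewrite -mulrA -mulrDr.
  have rec k : x k.+1 w = x k w - theta k *: residual X
      (fun z => regularized F Phi (lambda k) z + avg_error F G N xis x k w)
      (x k w) (eta k).
    by rewrite xstep (hatF_regularized _ F).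
  exact: path (x ^~ w) (fun k => avg_error F G N xis x k w) (xinit w) rec T.
have h0 k w : 0 <= h k w by exact: sqr_ge0.
have := mine_integral_le_avg P h0 h_sum.
have mean_sum := @affine_mean_le _ _ _ P W v _ _ T
  (mulr_ge0 (ltW sT0) A0) (mulr_ge0 (ltW sT0) B0)
  (fun k w => sqr_ge0 _) mW mean_W.
move=> /le_trans /(_ mean_sum); rewrite -lee_pdivlMl// => min_le.
have meanE k : ('E_P[h k] = \int[P]_w (h k w)%:E)%E by rewrite unlock.
rewrite (eq_bigr (fun k : 'I_T => \int[P]_w (h k w)%:E)%E); last first.
  by move=> k _; exact: meanE.
apply: le_trans min_le _.
rewrite -EFinM lee_fin ler_pdivlMr//.
have TE : T%:R = Num.sqrt T%:R ^+ 2 :> R by rewrite sqr_sqrtr// ltW.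
have -> : T%:R^-1 *
    (Num.sqrt T%:R * A * (\sum_(k < T) v k) + Num.sqrt T%:R * B) *
    Num.sqrt T%:R = A * (\sum_(k < T) v k) + B :> R.
  by rewrite [X in X^-1]TE; field; rewrite gt_eqF.
by have := ler_wpM2l A0 (sum_v T); rewrite /K; lra.
Qed.
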